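(* Let $\mathcal{H}_b(V_b,E_b,W_b)$ be a hypergraph with vertex set $V_b=\{1,2,\dots,n\}$, let $m\ge\max\{|e|:e\in E_b\}$, $m\ge 2$, and let $\{\mathcal{H}_i(V_i,E_i,W_i):i=1,2,\dots,n\}$ be a collection of regular $m$-uniform hypergraphs. Let $\mathcal{H}(V,E,W)$ be the $m$-uniform hypergraph constructed by taking $\mathcal{H}_b$ as backbone hypergraph and the $\mathcal{H}_i$'s as participants. Then for every $p\in\{1,\dots,n\}$ and every non-Perron eigenvalue $\lambda$ of $A_{\mathcal{H}_p}$ with multiplicity $l$, the number $$\lambda-\sum_{e\in E_b,\;p\in e}W_b(e)\,d^{S_e(m)}_{pp}$$ is an eigenvalue of $A_{\mathcal{H}}$ with multiplicity at least $l$.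
   Context: A (weighted) hypergraph $\mathcal{H}(V,E,W)$ consists of a finite nonempty vertex set $V$, a set $E$ of subsets of $V$ of size at least $2$ (edges), and a weight function $W:E\to\mathbb{R}_{\ge 0}$. It is $m$-uniform if all edges have size $m$. Its adjacency matrix $A_{\mathcal{H}}$ has zero diagonal and $(A_{\mathcal{H}})_{ij}=\sum_{e\in E;\,i,j\in e}\frac{W(e)}{|e|-1}$ for $i\neq j$. The valency of a vertex $i$ is $\sum_{e\in E,\,i\in e}W(e)$; $\mathcal{H}$ is $r$-regular if all valencies equal $r$, and regular if it is $r$-regular for some $r$. For an $r$-regular hypergraph the Perron eigenvalue is $r$, with the all-ones eigenvector; the non-Perron eigenvalues, with their multiplicities, are those remaining after removing one copy of $r$ from the spectrum, i.e. the eigenvalues of $A_{\mathcal{H}}$ restricted to the orthogonal complement of the all-ones vector. Backbone construction: the vertex sets $V_1,\dots,V_n$ are taken pairwise disjoint. The hypergraph $\mathcal{H}$ has vertex set $V=\bigcup_i V_i$; its edges are all edges of the $\mathcal{H}_i$ (with their weights $W_i$) together with, for each $e\in E_b$, every $m$-subset $\eta\subseteq\bigcup_{j\in e}V_j$ with $\eta\cap V_j\ne\emptyset$ for all $j\in e$, which is given the weight $W_b(e)$. For $e\in E_b$ put $S_e=\{\mathcal{H}_j:j\in e\}$ and $n_j=|V_j|$. For $p\in e$ with $n_p\ge 2$, $d^{S_e(m)}_{pp}$ is $\frac1{m-1}$ times the number of $m$-subsets $\eta\subseteq\bigcup_{j\in e}V_j$ that meet every $V_j$, $j\in e$, and contain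 two fixed distinct vertices of $V_p$; that is, $$d^{S_e(m)}_{pp}=\frac1{m-1}\sum\binom{n_p-2}{i_p}\prod_{j\in e\setminus\{p\}}\binom{n_j}{i_j},$$ summed over integers $i_p\ge 0$ and $i_j\ge 1$ $(j\in e\setminus\{p\})$ with $\sum_{j\in e}i_j=m-2$. *)

(* Defs.v *)
From mathcomp Require Import all_boot all_order all_algebra.
From mathcomp Require Import reals.
Set Implicit Arguments.
Unset Strict Implicit.
Unset Printing Implicit Defensive.
Import Order.TTheory GRing.Theory Num.Theory.
Local Open Scope ring_scope.

(* The weight function is total on {set V}; only its values on the edges are
   meaningful. *)
Record hypergraph (R : realType) (V : finType) := Hypergraph {
  edges : {set {set V}};
  weight : {set V} -> R;
  vertex_gt0 : (0 < #|V|)%N;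
  edge_size : forall e, e \in edges -> (2 <= #|e|)%N;
  weight_ge0 : forall e, e \in edges -> 0 <= weight e }.

Definition uniform (R : realType) (V : finType) (m : nat)
    (H : hypergraph R V) : Prop :=
  forall e, e \in edges H -> #|e| = m.

Definition valency (R : realType) (V : finType) (H : hypergraph R V)
    (i : V) : R :=
  \sum_(e in edges H | i \in e) weight H e.

Definition regular_of (R : realType) (V : finType) (r : R)
    (H : hypergraph R V) : Prop :=
  forall i, valency H i = r.

Definition regular (R : realType) (V : finType) (H : hypergraph R V) : Prop :=
  exists r, regular_of r H.

Definition adjacency (R : realType) (V : finType) (H : hypergraph R V)
    (i j : V) : R :=
  if i == j then 0
  else \sum_(e in edges H | (i \in e) && (j \in e))
         weight H e / (#|e| - 1)%N%:R.

Definition adj_mx (R : realType) (V : finType) (H : hypergraph R V) :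
    'M[R]_#|V| :=
  \matrix_(i, j) adjacency H (enum_val i) (enum_val j).

(* Multiplicity of x in the spectrum, i.e. the multiset of the roots of the
   characteristic polynomial; it is 0 when x is not an eigenvalue. *)
Definition multiplicity (R : realType) (k : nat) (A : 'M[R]_k) (x : R) : nat :=
  mup x (char_poly A).

(* Multiplicity of x after one copy of r is removed from the spectrum. *)
Definition nonperron_multiplicity (R : realType) (k : nat) (A : 'M[R]_k)
    (r x : R) : nat :=
  (multiplicity A x - (x == r))%N.

(* The disjoint union of the vertex sets is {i : 'I_n & V i}; V_j is embedded in
   it by Tagged, with image part V j. *)
Definition part (n : nat) (V : 'I_n -> finType) (j : 'I_n) :
    {set {i : 'I_n & V i}} :=
  [set x | tag x == j].

Definition lift_edge (n : nat) (V : 'I_n -> finType) (j : 'I_n)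
    (f : {set V j}) : {set {i : 'I_n & V i}} :=
  [set Tagged V x | x in f].

Definition crossing (n : nat) (V : 'I_n -> finType) (m : nat) (e : {set 'I_n})
    (eta : {set {i : 'I_n & V i}}) : bool :=
  [&& #|eta| == m, eta \subset \bigcup_(j in e) part V j
    & [forall j in e, eta :&: part V j != set0]].

Section Backbone.
Variables (R : realType) (n : nat) (V : 'I_n -> finType) (m : nat).
Variables (Hb : hypergraph R 'I_n) (H : forall i, hypergraph R (V i)).

Definition backbone_edges : {set {set {i : 'I_n & V i}}} :=
  (\bigcup_i [set lift_edge f | f in edges (H i)])
  :|: [set eta | [exists e in edges Hb, crossing m e eta]].

(* Exactly one term is present when eta is an edge: see backbone_weight_lift and
   backbone_weight_crossing below. *)
Definition backbone_weight (eta : {set {i : 'I_n & V i}}) : R :=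
  \sum_i \sum_(f in edges (H i) | lift_edge f == eta) weight (H i) f
  + \sum_(e in edges Hb | crossing m e eta) weight Hb e.

Lemma lift_edge_inj j : injective (@lift_edge n V j).
Proof. by apply: imset_inj => x y /eqP; rewrite eq_Tagged => /eqP. Qed.

Lemma tag_lift_edge j (f : {set V j}) x : x \in lift_edge f -> tag x = j.
Proof. by case/imsetP => y _ ->. Qed.

Lemma crossing_tag (e : {set 'I_n}) (eta : {set {i : 'I_n & V i}}) :
  crossing m e eta -> [set tag x | x in eta] = e.
Proof.
case/and3P=> _ /subsetP sub /forall_inP meet; apply/setP => j.
apply/imsetP/idP => [[x xeta ->]|je].
  by have /bigcupP[k ke] := sub _ xeta; rewrite inE => /eqP ->.
by have /set0Pn[x] := meet _ je; rewrite !inE => /andP[xeta /eqP <-]; exists x.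
Qed.

Lemma backbone_edge_size eta : eta \in backbone_edges -> (2 <= #|eta|)%N.
Proof.
rewrite inE => /orP[/bigcupP[i _ /imsetP[f fE ->]]|].
  rewrite card_imset ?(edge_size fE) // => x y /eqP.
  by rewrite eq_Tagged => /eqP.
rewrite inE => /exists_inP[e eE /crossing_tag tag_eta].
by rewrite (leq_trans (edge_size eE)) // -tag_eta leq_imset_card.
Qed.

Lemma backbone_weight_ge0 eta : 0 <= backbone_weight eta.
Proof.
apply: addr_ge0; apply: sumr_ge0 => i.
  by move=> _; apply: sumr_ge0 => f /andP[fE _]; apply: weight_ge0.
by case/andP=> iE _; apply: weight_ge0.
Qed.

Lemma lift_edge_not_crossing j (f : {set V j}) e :
  e \in edges Hb -> crossing m e (lift_edge f) = false.
Proof.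
move=> eE; apply/negP => /crossing_tag tag_f.
have : (#|e| <= #|[set j]|)%N.
  apply/subset_leq_card/subsetP => k; rewrite -tag_f => /imsetP[x xf ->].
  by rewrite inE (tag_lift_edge xf).
by rewrite cards1 leqNgt (edge_size eE).
Qed.

Lemma lift_edge_eq_index i j (f : {set V i}) (g : {set V j}) :
  f \in edges (H i) -> lift_edge f = lift_edge g -> i = j.
Proof.
move=> fE fg; have /card_gt0P[x xf] : (0 < #|f|)%N by rewrite ltnW ?(edge_size fE).
have : Tagged V x \in lift_edge f by apply: imset_f.
by rewrite fg => /tag_lift_edge.
Qed.

Lemma backbone_weight_lift j (f : {set V j}) :
  f \in edges (H j) -> backbone_weight (lift_edge f) = weight (H j) f.
Proof.
move=> fE; rewrite /backbone_weight [X in _ + X]big1 => [|e /andP[eE]]; last first.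
  by rewrite lift_edge_not_crossing.
rewrite addr0 (bigD1 j) //= [X in _ + X]big1 => [|i ij]; last first.
  rewrite big1 // => g /andP[gE /eqP gf].
  by rewrite (lift_edge_eq_index gE gf) eqxx in ij.
rewrite addr0 (bigD1 f) /= ?fE ?eqxx // big1 ?addr0 // => g.
by case/andP => /andP[_ /eqP/lift_edge_inj ->]; rewrite eqxx.
Qed.

Lemma backbone_weight_crossing e eta :
  e \in edges Hb -> crossing m e eta -> backbone_weight eta = weight Hb e.
Proof.
move=> eE cross; rewrite /backbone_weight big1 => [|i _]; last first.
  rewrite big1 // => f /andP[_ /eqP f_eta].
  by rewrite -f_eta lift_edge_not_crossing in cross.
rewrite add0r (bigD1 e) /= ?eE // big1 ?addr0 // => e'.
case/andP=> /andP[_ /crossing_tag <-].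
by rewrite (crossing_tag cross) eqxx.
Qed.

Lemma backbone_vertex_gt0 : (0 < #|{: {i : 'I_n & V i}}|)%N.
Proof.
have /card_gt0P[i _] := vertex_gt0 Hb.
have /card_gt0P[x _] := vertex_gt0 (H i).
by apply/card_gt0P; exists (Tagged V x).
Qed.

Definition backbone : hypergraph R {i : 'I_n & V i} :=
  Hypergraph backbone_vertex_gt0 backbone_edge_size
    (fun eta _ => backbone_weight_ge0 eta).

Lemma backbone_uniform :
  (forall i, uniform m (H i)) -> uniform m backbone.
Proof.
move=> Hm eta; rewrite inE => /orP[/bigcupP[i _ /imsetP[f fE ->]]|].
  rewrite card_imset ?(Hm _ _ fE) // => x y /eqP.
  by rewrite eq_Tagged => /eqP.
by rewrite inE => /exists_inP[e _ /and3P[/eqP]].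
Qed.

End Backbone.

(* sz j stands for the number of vertices of V_j, and the index i ranges over
   the families (i_j) with j in e, extended by 0 outside e.  The bound i_j < m
   loses nothing, as the i_j add up to m - 2. *)
Definition d_coef (R : realType) (n : nat) (sz : 'I_n -> nat) (m : nat)
    (e : {set 'I_n}) (p : 'I_n) : R :=
  (m - 1)%N%:R^-1 *
  \sum_(i : {ffun 'I_n -> 'I_m} |
          [&& [forall j in ~: e, i j == 0%N :> nat],
              [forall j in e :\ p, (0 < i j)%N]
            & (\sum_(j in e) i j == m - 2)%N])
    ('C(sz p - 2, i p) * \prod_(j in e :\ p) 'C(sz j, i j))%N%:R.

(* Main.v *)
Require Import Defs.
From mathcomp Require Import all_boot all_order all_algebra.
From mathcomp Require Import perm reals.
Import Order.TTheory GRing.Theory Num.Theory.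

(** Write B for the adjacency matrix of H_p, A for that of the whole hypergraph,
    and c for the sum of W_b(e) d_pp over the backbone edges e through p.  Two
    distinct vertices of V_p are joined in A by the edges of H_p and by the
    crossing edges, and the latter contribute c whatever the two vertices are; so
    A is B + c (J - I) on the block of V_p, with J the all-ones matrix.  Moreover
    a vertex outside V_p cannot tell the vertices of V_p apart: exchanging two of
    them permutes the crossing sets, so its entry in A is constant along V_p.
    Hence a vector on V_p with zero sum, extended by 0, is sent by A to the
    extension of its image under B - c I (embed_adj_mx): J and the other blocks
    kill it.

    Multiplicities are those of roots of characteristic polynomials, so this is
    used through invariant subspaces.  As the rows of B all sum to r, the matrix C
    of B on the zero-sum vectors satisfies char_poly B = (X - r) char_poly C
    (char_poly_const_rowsum), hence the multiplicity of lambda for C is the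
    non-Perron multiplicity of lambda for B.  The zero-sum vectors embed as an
    A-invariant subspace where A acts as C - c I, and the characteristic
    polynomial on an invariant subspace divides the whole one
    (char_poly_invariant_dvdp); so lambda - c has at least that multiplicity
    for A.

    Identifying c is a count (card_pair_crossings): removing two fixed vertices
    of V_p from a crossing m-set leaves an (m - 2)-set that meets the other parts
    of e, and these are counted according to the sizes of their traces on the
    parts, each size vector giving a product of binomial coefficients. *)

Set Implicit Arguments.
Unset Strict Implicit.
Unset Printing Implicit Defensive.
Local Open Scope ring_scope.

(** * Characteristic polynomials and invariant subspaces *)

Section CharPoly.
Variable F : fieldType.

Lemma char_poly_mxE k (A : 'M[F]_k) :
  char_poly_mx A = 'X%:M - map_mx polyC A.
Proof. by []. Qed.

Lemma char_poly_neq0 k (A : 'M[F]_k) : char_poly A != 0.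
Proof. by rewrite monic_neq0 ?char_poly_monic. Qed.

Lemma char_poly_similar k (P A B : 'M[F]_k) :
  P \in unitmx -> P *m A = B *m P -> char_poly A = char_poly B.
Proof.
move=> Punit PA; have detP : \det (map_mx polyC P) != 0.
  by rewrite det_map_mx polyC_eq0 -unitfE -unitmxE.
apply: (mulfI detP); rewrite [RHS]mulrC -!det_mulmx !char_poly_mxE.
by rewrite mulmxBr mulmxBl -!map_mxM PA scalar_mxC.
Qed.

Lemma char_poly_lblock a b (C : 'M[F]_a) (Y : 'M_(b, a)) (D : 'M_b) :
  char_poly (block_mx C 0 Y D) = char_poly C * char_poly D.
Proof.
rewrite /char_poly char_poly_mxE map_block_mx map_mx0 (scalar_mx_block a b).
by rewrite opp_block_mx add_block_mx oppr0 addr0 det_lblock.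
Qed.

Lemma char_poly_ublock a b (C : 'M[F]_a) (Y : 'M_(a, b)) (D : 'M_b) :
  char_poly (block_mx C Y 0 D) = char_poly C * char_poly D.
Proof.
rewrite /char_poly char_poly_mxE map_block_mx map_mx0 (scalar_mx_block a b).
by rewrite opp_block_mx add_block_mx oppr0 addr0 det_ublock.
Qed.

(** The rows of U span a subspace that A maps to itself, with matrix C.  Once U
    is completed to a basis of the whole space, A becomes block triangular with
    C as a diagonal block. *)
Lemma char_poly_invariant_dvdp a k (C : 'M[F]_a) (U : 'M_(a, k)) (A : 'M_k) :
  row_free U -> U *m A = C *m U -> char_poly C %| char_poly A.
Proof.
move=> freeU; have le_ak : (a <= k)%N by rewrite -(eqP freeU) rank_leq_col.
have [b def_k] : exists b, k = (a + b)%N by exists (k - a)%N; rewrite subnKC.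
subst k => UA.
(* U is the first block of rows of P, the other rows being those of a completion. *)
pose P := block_mx (col_ebase U) 0 0 1%:M *m row_ebase U.
have Punit : P \in unitmx.
  rewrite unitmx_mul row_ebase_unit andbT unitmxE det_ublock det1 mulr1.
  by rewrite -unitmxE col_ebase_unit.
have defU : usubmx P = U.
  rewrite -mul_usub_mx block_mxEv col_mxKu -[RHS]mulmx_ebase; congr (_ *m _).
  by rewrite (eqP freeU) pid_mx_row mul_mx_row mulmx1 mulmx0.
pose D := dsubmx P *m A *m invmx P.
pose Q := block_mx C 0 (lsubmx D) (rsubmx D).
have PA : P *m A = Q *m P.
  have defP : P = col_mx U (dsubmx P) by rewrite -[in RHS]defU vsubmxK.
  rewrite [X in X *m A]defP mul_col_mx [X in _ = _ *m X]defP mul_block_col.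
  by rewrite mul0mx addr0 UA -mul_row_col hsubmxK -defP mulmxKV.
by rewrite (char_poly_similar Punit PA) char_poly_lblock dvdp_mulr.
Qed.

(** The all-ones column is an eigenvector of B for r.  The rows of U are a basis
    of its annihilator, that is of the row vectors with zero sum, which B therefore
    preserves; what is left is the eigenvalue r on the quotient by them. *)
Lemma char_poly_const_rowsum k (B : 'M[F]_k.+1) r :
  B *m const_mx 1 = r *: (const_mx 1 : 'cV_k.+1) ->
  exists (U : 'M_(k, k.+1)) (C : 'M_k), [/\ row_free U,
    U *m (const_mx 1 : 'cV_k.+1) = 0, U *m B = C *m U
    & char_poly B = ('X - r%:P) * char_poly C].
Proof.
(* The vectors e_i - e_0, and their completion P by e_0. *)
move=> B1; pose U : 'M[F]_(k, 1 + k) := row_mx (const_mx (- 1)) 1%:M.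
pose P : 'M[F]_(1 + k) := block_mx 1%:M 0 (const_mx (- 1)) 1%:M.
have one_col : const_mx 1 = col_mx 1%:M (const_mx 1) :> 'cV[F]_(1 + k).
  by rewrite -col_mx_const; congr col_mx; apply/matrixP=> i j; rewrite !ord1 !mxE.
have U1 : U *m (const_mx 1 : 'cV[F]_(1 + k)) = 0.
  rewrite one_col mul_row_col mulmx1 mul1mx.
  by apply/matrixP=> i j; rewrite !mxE addNr.
have Punit : P \in unitmx by rewrite unitmxE det_lblock !det1 mulr1 unitr1.
have P1 : P *m (const_mx 1 : 'cV[F]_(1 + k)) = col_mx 1%:M 0.
  rewrite one_col mul_block_col mulmx1 mul0mx addr0; congr col_mx.
  by rewrite mulmx1 mul1mx; apply/matrixP=> i j; rewrite !mxE addNr.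
pose D : 'M[F]_(1 + k) := P *m B *m invmx P.
have D1 : D *m col_mx 1%:M 0 = r *: col_mx 1%:M 0.
  rewrite -P1 mulmxA mulmxKV // -mulmxA.
  by rewrite (B1 : B *m (const_mx 1 : 'cV[F]_(1 + k)) = _) scalemxAr.
have [Dul Ddl] : ulsubmx D = r%:M /\ dlsubmx D = 0.
  move: D1; rewrite -{1}(submxK D) mul_block_col !mulmx0 !addr0 !mulmx1.
  by rewrite scale_col_mx scaler0 scalemx1 => /eq_col_mx.
have DP : P *m B = D *m P by rewrite mulmxKV.
have PdU : P = col_mx (row_mx 1%:M 0) U by rewrite /P block_mxEv.
exists U, (drsubmx D); split.
- rewrite -row_leq_rank -{1}(mxrank1 F k).
  apply: leq_trans (mxrankM_maxl U (col_mx 0 1%:M)).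
  by rewrite mul_row_col mulmx0 add0r mulmx1.
- exact: U1.
- move: DP; rewrite -{1}(submxK D) Ddl {1}PdU mul_col_mx PdU mul_block_col mul0mx.
  by rewrite add0r => /eq_col_mx[].
- rewrite (char_poly_similar Punit DP) -{1}(submxK D) Ddl Dul char_poly_ublock.
  by congr (_ * _); rewrite /char_poly det_mx11 !mxE eqxx mulr1n.
Qed.

Lemma char_poly_shift k (C : 'M[F]_k) c :
  char_poly (C - c%:M) = char_poly C \Po ('X + c%:P).
Proof.
rewrite /char_poly -[RHS]det_map_mx; congr (\det _).
apply/matrixP=> i j; rewrite !mxE /= comp_polyB comp_polyC.
case: (i == j); last by rewrite !mulr0n subr0 comp_polyC.
by rewrite !mulr1n comp_polyX polyCB opprB addrA addrAC.
Qed.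

Lemma mup_char_poly_shift k (C : 'M[F]_k) c x :
  (mup x (char_poly C) <= mup (x - c) (char_poly (C - c%:M)))%N.
Proof.
rewrite mup_geq ?char_poly_neq0 // char_poly_shift.
have : ('X - x%:P) ^+ mup x (char_poly C) %| char_poly C.
  by rewrite -mup_geq ?char_poly_neq0.
move: (mup x _) => l /dvdpP[q ->].
rewrite comp_polyM rmorphXn /= comp_polyB comp_polyX comp_polyC.
rewrite polyCB opprB addrA; exact: dvdp_mull.
Qed.

Lemma mup_leq_dvdp x (p q : {poly F}) :
  q != 0 -> p %| q -> (mup x p <= mup x q)%N.
Proof.
move=> q0 pq; have p0 : p != 0 by apply: contraTneq pq => ->; rewrite dvd0p.
by rewrite mup_geq // (dvdp_trans _ pq) // -mup_geq.
Qed.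

(** The rows of E embed the space of B into that of A, and E intertwines B - c
    with A up to a matrix all of whose rows are w.  Zero-sum vectors kill this
    error term, so they embed as a subspace invariant under A. *)
Lemma mup_char_poly_embedding k N (B : 'M[F]_k) (A : 'M[F]_N) (E : 'M[F]_(k, N))
    (w : 'rV[F]_N) r c x :
    (0 < k)%N -> row_free E ->
    B *m const_mx 1 = r *: (const_mx 1 : 'cV_k) ->
    E *m A = (B - c%:M) *m E + const_mx 1 *m w ->
  (mup x (char_poly B) - (x == r) <= mup (x - c) (char_poly A))%N.
Proof.
case: k => // k in B E * => _ freeE B1 EA.
have [U [C [freeU U1 UB ->]]] := char_poly_const_rowsum B1.
rewrite mupM ?char_poly_neq0 ?polyXsubC_eq0 // (mup_XsubCX 1) eq_sym.
rewrite (_ : (if _ then _ else _) = nat_of_bool (x == r)); last by case: eqP.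
rewrite addKn (leq_trans (mup_char_poly_shift C c x)) // mup_leq_dvdp ?char_poly_neq0 //.
apply: (@char_poly_invariant_dvdp _ _ _ (U *m E)).
  by rewrite /row_free mxrankMfree.
rewrite -mulmxA EA mulmxDr !mulmxA U1 mul0mx addr0 mulmxBr mulmxBl.
by rewrite UB scalar_mxC !mulmxBl.
Qed.

End CharPoly.

(** * Counting sets by the sizes of their fibres *)

(** A set is the same thing as the family of its fibres over I, which can be
    chosen independently of each other. *)
Lemma card_sets_with_fibre_sizes (I T : finType) (c : T -> I) (A : {set T})
    (k : I -> nat) :
  #|[set S : {set T} | (S \subset A) &&
       [forall j, #|S :&: [set x | c x == j]| == k j]]|
    = (\prod_j 'C(#|A :&: [set x | c x == j]|, k j))%N.
Proof.
pose F j := [set B : {set T} | (B \subset A :&: [set x | c x == j]) & #|B| == k j].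
pose f (S : {set T}) : {ffun I -> {set T}} := [ffun j => S :&: [set x | c x == j]].
have f_inj : injective f.
  move=> S S' /ffunP eqf; apply/setP => x.
  by have /setP/(_ x) := eqf (c x); rewrite !ffunE !inE eqxx !andbT.
under [RHS]eq_bigr do rewrite -cards_draws -/(F _).
transitivity #|family (fun j => mem (F j))|; last first.
  by rewrite card_family foldrE big_image; apply: eq_bigr.
rewrite -(card_imset _ f_inj); apply: eq_card => g.
apply/imsetP/familyP => [[S /[!inE] /andP[SA /forallP Sk] -> j]|gF].
  by rewrite ffunE inE Sk setSI.
have gP j : (g j \subset A :&: [set x | c x == j]) && (#|g j| == k j).
  by have := gF j; rewrite inE.
have defg : g = f (\bigcup_j g j).
  apply/ffunP => j; rewrite ffunE; apply/setP => x; rewrite !inE.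
  apply/idP/andP => [xg|[/bigcupP[i _ xg] /eqP <-]].
    split; first by apply/bigcupP; exists j.
    by have /andP[/subsetP/(_ x xg)] := gP j; rewrite !inE => /andP[].
  by have /andP[/subsetP/(_ x xg)] := gP i; rewrite !inE => /andP[_ /eqP ->].
exists (\bigcup_j g j) => //; rewrite inE; apply/andP; split.
  apply/bigcupsP => j _; have /andP[gA _] := gP j.
  by rewrite (subset_trans gA) ?subsetIl.
apply/forallP => j; have /andP[_ gk] := gP j.
by have /ffunP/(_ j) := defg; rewrite ffunE => <-.
Qed.

Lemma card_fibres (I T : finType) (c : T -> I) (S : {set T}) :
  #|S| = (\sum_j #|S :&: [set x | c x == j]|)%N.
Proof.
rewrite -sum1_card (partition_big c predT) //=; apply: eq_bigr => j _.
by rewrite -sum1_card; apply: eq_bigl => x; rewrite !inE.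
Qed.

(** * Crossing sets through two vertices *)

Section Crossing.
Variables (n : nat) (V : 'I_n -> finType).
Local Notation T := {i : 'I_n & V i}.

Lemma part_lift_edge j : part V j = lift_edge [set: V j].
Proof.
apply/setP=> x; rewrite inE; apply/eqP/imsetP => [<-|[y _ ->] //].
by exists (tagged x) => //; case: x.
Qed.

Lemma card_part j : #|part V j| = #|V j|.
Proof.
rewrite part_lift_edge card_imset ?cardsT // => x y /eqP.
by rewrite eq_Tagged => /eqP.
Qed.

Definition pair_crossings m (e : {set 'I_n}) (u v : T) : {set {set T}} :=
  [set eta | crossing m e eta & (u \in eta) && (v \in eta)].

(** The part V_p is met by u and v already, so once they are removed the remaining
    set may avoid it. *)
Lemma card_pair_crossings_reduced m (e : {set 'I_n}) p (u v : T) :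
    p \in e -> tag u = p -> tag v = p -> u != v ->
  #|pair_crossings m.+2 e u v| =
  #|[set S : {set T} |
      [&& S \subset (\bigcup_(j in e) part V j) :\: [set u; v], #|S| == m
        & [forall j in e :\ p, S :&: part V j != set0]]]|.
Proof.
move=> pe up vp uv; set Y := [set S | _].
have eB : [set u; v] \subset \bigcup_(j in e) part V j.
  by rewrite subUset !sub1set; apply/andP; split; apply/bigcupP; exists p;
    rewrite ?inE ?up ?vp.
have disj S : S \in Y -> [disjoint S & [set u; v]].
  by rewrite inE subsetD => /andP[/andP[]].
have addK S : S \in Y -> (S :|: [set u; v]) :\: [set u; v] = S.
  by move=> /disj/setDidPl; rewrite setDUl setDv setU0.
have addI : {in Y &, injective (fun S : {set T} => S :|: [set u; v])}.
  by move=> S S' /addK defS /addK defS' eqS; rewrite -defS eqS defS'.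
rewrite -(card_in_imset addI); apply: eq_card => eta.
rewrite inE; apply/andP/imsetP => [[/and3P[/eqP sz etae /forall_inP meet]]|].
  case/andP=> u_eta v_eta; have eta_uv : [set u; v] \subset eta.
    by rewrite subUset !sub1set u_eta.
  exists (eta :\: [set u; v]); last by rewrite setUC setDE setUIr setUCr setIT;
    rewrite (setUidPr eta_uv).
  rewrite inE setSD //= cardsDS // sz cards2 uv !subSS subn0 eqxx /=.
  apply/forall_inP => j /setD1P[jp je]; have /set0Pn[x] := meet j je.
  rewrite !inE => /andP[xeta xj]; apply/set0Pn; exists x.
  rewrite !inE xeta xj !andbT negb_or; apply/andP.
  by split; apply: contraNneq jp => xE; rewrite -(eqP xj) xE ?up ?vp.
move=> [S SY ->]; rewrite !inE !eqxx !orbT; split=> //.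
have SB := disj S SY; move: SY; rewrite inE subsetD => /and3P[/andP[Se _] /eqP sz].
move=> /forall_inP meet; apply/and3P; split.
- by rewrite cardsU (disjoint_setI0 SB) cards0 subn0 sz cards2 uv addn2.
- by rewrite subUset Se.
apply/forall_inP => j je; have [->|jp] := eqVneq j p.
  by apply/set0Pn; exists u; rewrite !inE eqxx orbT up eqxx.
have /set0Pn[x] : S :&: part V j != set0 by apply: meet; rewrite !inE jp.
by rewrite inE => /andP[xS xj]; apply/set0Pn; exists x; rewrite inE xj inE xS.
Qed.

(** The index of summation of d_coef is the vector of the sizes of the traces on
    the parts of a set obtained by removing u and v from a crossing set. *)
Lemma card_pair_crossings (R : realType) m (e : {set 'I_n}) p (u v : T) :
    (2 <= m)%N -> p \in e -> tag u = p -> tag v = p -> u != v ->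
  #|pair_crossings m e u v|%:R / (m - 1)%N%:R =
    d_coef R (fun j => #|V j|) m e p.
Proof.
case: m => [|[|m]] // _ pe up vp uv; rewrite mulrC /d_coef; congr (_ * _).
rewrite (card_pair_crossings_reduced m pe up vp uv) -natr_sum; congr _%:R.
set A := _ :\: _; set Y := [set S | _].
have Acard j : #|A :&: part V j| =
    if j == p then (#|V p| - 2)%N else if j \in e then #|V j| else 0%N.
  have [->|jp] := eqVneq j p.
    have -> : A :&: part V p = part V p :\: [set u; v].
      apply/setP => x; rewrite !inE -andbA; congr (_ && _); apply: andb_idl => xp.
      by apply/bigcupP; exists p; rewrite ?inE.
    rewrite cardsDS ?card_part ?cards2 ?uv //.
    by rewrite subUset !sub1set !inE up vp eqxx.
  case: ifP => je.
    rewrite -card_part; apply: eq_card => x; rewrite !inE.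
    apply: andb_idl => xj; apply/andP; split.
      by rewrite negb_or; apply/andP; split; apply: contraNneq jp => xE;
        rewrite -(eqP xj) xE ?up ?vp.
    by apply/bigcupP; exists j; rewrite ?inE.
  apply/eqP; rewrite cards_eq0; apply/eqP/setP => x; rewrite !inE.
  apply/negP => /andP[/andP[_ /bigcupP[i ie]]]; rewrite inE => /eqP xi /eqP xj.
  by rewrite -xj xi ie in je.
(* Sets in Y have m elements, so the traces have size less than m.+2 and inord
   returns that size. *)
pose prof (S : {set T}) : {ffun 'I_n -> 'I_m.+2} :=
  [ffun j => inord #|S :&: part V j|].
have profE S j : S \in Y -> prof S j = #|S :&: part V j| :> nat.
  rewrite inE => /and3P[_ /eqP sz _]; rewrite ffunE inordK // ltnS.
  by rewrite (leq_trans (subset_leq_card (subsetIl _ _))) // sz leqnSn.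
have out (S : {set T}) j : S \subset A -> j \notin e -> #|S :&: part V j| = 0%N.
  move=> SA je; apply/eqP; rewrite -leqn0 (leq_trans (subset_leq_card (setSI _ SA))) //.
  by rewrite Acard (negPf je); case: eqP je => // ->; rewrite pe.
have sumE (S : {set T}) : S \subset A -> #|S| = (\sum_(j in e) #|S :&: part V j|)%N.
  move=> SA; rewrite (card_fibres tag S) (bigID (mem e)) /= [X in (_ + X)%N]big1.
    by rewrite addn0.
  by move=> j /(out S j SA).
rewrite -sum1_card.
rewrite (partition_big prof (fun i : {ffun 'I_n -> 'I_m.+2} =>
  [&& [forall j in ~: e, i j == 0%N :> nat], [forall j in e :\ p, (0 < i j)%N]
    & (\sum_(j in e) i j == m.+2 - 2)%N])) /=; last first.
  move=> S SY; have := SY; rewrite inE => /and3P[SA /eqP sz /forall_inP meet].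
  apply/and3P; split.
  - by apply/forall_inP => j; rewrite inE => je; rewrite profE // out.
  - by apply/forall_inP => j je; rewrite profE // card_gt0 meet.
  - by under eq_bigr do rewrite profE //; rewrite -sumE // sz !subSS subn0.
apply: eq_bigr => i /and3P[/forall_inP i0 /forall_inP ipos /eqP isum].
transitivity #|[set S : {set T} | (S \subset A) &&
       [forall j, #|S :&: [set x | tag x == j]| == i j]]|.
  rewrite -sum1_card; apply: eq_bigl => S; rewrite [RHS]inE.
  apply/andP/andP => [[SY /eqP <-]|[SA /forallP Si]].
    split; first by move: SY; rewrite inE => /andP[].
    by apply/forallP => j; rewrite profE.
  have SY : S \in Y.
    rewrite inE SA sumE //=; apply/andP; split.
      by under eq_bigr do rewrite (eqP (Si _)); rewrite isum !subSS subn0.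
    by apply/forall_inP => j /ipos; rewrite -card_gt0 (eqP (Si j)).
  by split=> //; apply/eqP/ffunP => j; apply: val_inj; rewrite /= profE // (eqP (Si j)).
rewrite card_sets_with_fibre_sizes (bigD1 p) //= Acard eqxx; congr (_ * _)%N.
rewrite (bigID (mem (e :\ p))) /= [X in (_ * X)%N]big1 ?muln1.
  apply: eq_big => j; first by rewrite !inE; case: eqP.
  by rewrite !inE => /andP[_ /andP[jp je]]; rewrite Acard (negPf jp) je.
move=> j /andP[jp]; rewrite !inE jp /= => je.
by rewrite (eqP (i0 j _)) ?inE ?bin0.
Qed.

(** Only the cardinality of eta and the set of parts that it meets matter, which
    makes the invariance under permutations inside the parts evident. *)
Lemma crossingE m (e : {set 'I_n}) (eta : {set T}) :
  crossing m e eta = (#|eta| == m) && ([set tag x | x in eta] == e).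
Proof.
apply/idP/andP => [cr|[sz /eqP <-]].
  by split; [case/and3P: cr | apply/eqP; apply: crossing_tag cr].
apply/and3P; split=> //.
  by apply/subsetP => x xeta; apply/bigcupP; exists (tag x); rewrite ?imset_f ?inE.
apply/forall_inP => _ /imsetP[x xeta ->]; apply/set0Pn; exists x.
by rewrite !inE xeta eqxx.
Qed.

(** Exchanging u and u' maps the crossing sets through u and v bijectively onto
    those through u' and v. *)
Lemma card_pair_crossings_move m (e : {set 'I_n}) (u u' v : T) :
    tag u = tag u' -> v != u -> v != u' ->
  #|pair_crossings m e u v| = #|pair_crossings m e u' v|.
Proof.
move=> uu' vu vu'; pose s x := tperm u u' x.
have s_inj : injective s by apply: perm_inj.
have sK : involutive s by apply: tpermK.
have sv : s v = v by apply: tpermD; rewrite eq_sym.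
have stag x : tag (s x) = tag x by rewrite /s; case: tpermP => // ->.
have mem_s (eta : {set T}) x : (x \in s @: eta) = (s x \in eta).
  by rewrite -[in LHS](sK x) mem_imset.
rewrite -(card_imset _ (imset_inj s_inj)); apply: eq_card => eta.
have imsetK (S : {set T}) : s @: (s @: S) = S.
  by apply/setP => x; rewrite !mem_s sK.
rewrite -[in LHS](imsetK eta) mem_imset; last exact: imset_inj.
rewrite !inE !mem_s sv /s tpermL !crossingE card_imset // -imset_comp.
by rewrite (eq_imset _ stag).
Qed.

Lemma pair_crossings0 m (e : {set 'I_n}) (u v : T) :
  tag u \notin e -> pair_crossings m e u v = set0.
Proof.
move=> ue; apply/setP => eta; rewrite !inE crossingE -andbA.
apply/negP => /and4P[_ /eqP def_e u_eta _].
by rewrite -def_e imset_f in ue.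
Qed.

End Crossing.

(** * Row sums of the adjacency matrix *)

(** An edge e through x contributes W(e) / (|e| - 1) for each of its |e| - 1 other
    vertices. *)
Lemma sum_adjacency (R : realType) (V : finType) (G : hypergraph R V) x :
  \sum_y adjacency G x y = valency G x.
Proof.
rewrite (bigD1 x) //= {1}/adjacency eqxx add0r /valency.
under eq_bigr => y yx do rewrite /adjacency eq_sym (negPf yx).
rewrite (exchange_big_dep (fun e => (e \in edges G) && (x \in e))) /=; last first.
  by move=> y e _ /and3P[-> ->].
apply: eq_bigr => e /andP[eE xe].
rewrite (eq_bigl (mem (e :\ x))) => [|y]; last by rewrite !inE eE xe.
have e_ge2 := edge_size eE.
rewrite sumr_const (cardsD1 x e) xe add1n subn1 -[LHS]mulr_natr divfK // pnatr_eq0.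
by move: e_ge2; rewrite (cardsD1 x e) xe; case: #|_|.
Qed.

Lemma adj_mx_ones (R : realType) (V : finType) (G : hypergraph R V) r :
  regular_of r G ->
  adj_mx G *m const_mx 1 = r *: (const_mx 1 : 'cV_#|V|).
Proof.
move=> Gr; apply/matrixP => i j; rewrite !mxE mulr1 -(Gr (enum_val i)).
rewrite -sum_adjacency (reindex (fun k : 'I_#|V| => enum_val k)) /=; last first.
  exact: onW_bij (enum_val_bij V).
by apply: eq_bigr => k _; rewrite !mxE mulr1.
Qed.

(** * The adjacency matrix of the backbone construction *)

Section BackboneAdjacency.
Variables (R : realType) (n : nat) (V : 'I_n -> finType) (m : nat).
Variables (Hb : hypergraph R 'I_n) (H : forall i, hypergraph R (V i)).
Local Notation T := {i : 'I_n & V i}.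

Lemma backbone_weight_out eta :
  eta \notin backbone_edges m Hb H -> backbone_weight m Hb H eta = 0.
Proof.
rewrite inE negb_or => /andP[nlift ncross].
rewrite /backbone_weight [X in _ + X]big1 ?addr0 => [|e /andP[eE cr]].
  rewrite big1 // => i _; rewrite big1 // => f /andP[fE /eqP f_eta].
  by case/bigcupP: nlift; exists i => //; rewrite -f_eta imset_f.
by case/negP: ncross; rewrite inE; apply/exists_inP; exists e.
Qed.

Lemma backbone_adjacency (u v : T) : u != v ->
  adjacency (backbone m Hb H) u v =
    \sum_i \sum_(f in edges (H i) | (u \in lift_edge f) && (v \in lift_edge f))
       weight (H i) f / (#|f| - 1)%N%:R
    + \sum_(e in edges Hb)
        weight Hb e * (#|pair_crossings m e u v|%:R / (m - 1)%N%:R).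
Proof.
move=> uv; rewrite /adjacency (negPf uv) /=.
pose Q (eta : {set T}) := (u \in eta) && (v \in eta).
(* The weight vanishes off the edges, so the sum may range over all sets. *)
transitivity (\sum_(eta | Q eta)
    backbone_weight m Hb H eta / (#|eta| - 1)%N%:R).
  rewrite [RHS](bigID (mem (backbone_edges m Hb H))) /= [X in _ + X]big1.
    by rewrite addr0; apply: eq_bigl => eta; rewrite andbC.
  by move=> eta /andP[_ /backbone_weight_out ->]; rewrite mul0r.
under [LHS]eq_bigr do rewrite /backbone_weight mulrDl !mulr_suml.
rewrite big_split /=; congr (_ + _).
  rewrite exchange_big /=; apply: eq_bigr => i _.
  under [LHS]eq_bigr do rewrite mulr_suml.
  rewrite (exchange_big_dep (fun f => (f \in edges (H i)) && Q (lift_edge f))) /=.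
    apply: eq_bigr => f /andP[fE fQ]; rewrite (big_pred1 (lift_edge f)).
      rewrite card_imset // => x y /eqP; rewrite eq_Tagged => /eqP //.
    move=> eta; rewrite fE /= eq_sym /=; case: eqP => [->|]; by rewrite ?fQ ?andbF.
  by move=> eta f Qeta /andP[-> /eqP ->].
rewrite (exchange_big_dep (mem (edges Hb))) /= => [|eta e _ /andP[] //].
apply: eq_bigr => e eE.
rewrite (eq_bigr (fun _ => weight Hb e / (m - 1)%N%:R)); last first.
  by move=> eta /and3P[_ _ /and3P[/eqP ->]].
rewrite (eq_bigl (mem (pair_crossings m e u v))) => [|eta]; last first.
  by rewrite !inE eE andbC.
by rewrite sumr_const -[LHS]mulr_natr mulrAC mulrA.
Qed.

Lemma lifted_adjacency p (x y : V p) : x != y ->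
  \sum_i \sum_(f in edges (H i) |
            (Tagged V x \in lift_edge f) && (Tagged V y \in lift_edge f))
       weight (H i) f / (#|f| - 1)%N%:R = adjacency (H p) x y.
Proof.
move=> xy; rewrite /adjacency (negPf xy) (bigD1 p) //= [X in _ + X]big1 => [|i ip].
  rewrite addr0; apply: eq_bigl => f; rewrite !mem_imset // => a b /eqP;
  by rewrite eq_Tagged => /eqP.
rewrite big_pred0 // => f; apply/negP => /and3P[_ /tag_lift_edge /= pi _].
by rewrite pi eqxx in ip.
Qed.

Lemma lifted_adjacency0 (u v : T) : tag u != tag v ->
  \sum_i \sum_(f in edges (H i) | (u \in lift_edge f) && (v \in lift_edge f))
       weight (H i) f / (#|f| - 1)%N%:R = 0.
Proof.
move=> uv; rewrite big1 // => i _; rewrite big_pred0 // => f.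
apply/negP => /and3P[_ /tag_lift_edge ui /tag_lift_edge vi].
by rewrite ui vi eqxx in uv.
Qed.

Lemma backbone_adjacency_same_part p (x y : V p) : (2 <= m)%N -> x != y ->
  adjacency (backbone m Hb H) (Tagged V x) (Tagged V y) =
    adjacency (H p) x y
    + \sum_(e in edges Hb | p \in e)
        weight Hb e * d_coef R (fun j => #|V j|) m e p.
Proof.
move=> m_ge2 xy; have xy' : Tagged V x != Tagged V y by rewrite eq_Tagged.
rewrite backbone_adjacency // lifted_adjacency //; congr (_ + _).
rewrite (bigID (fun e : {set _} => p \in e)) /= [X in _ + X]big1 ?addr0.
  by apply: eq_bigr => e /andP[_ pe]; rewrite (card_pair_crossings R m_ge2 pe).
by move=> e /andP[_ pe]; rewrite pair_crossings0 // cards0 mul0r mulr0.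
Qed.

(** No edge of a participant joins different parts, so only the crossing sets count
    here, and exchanging x and x' matches them. *)
Lemma backbone_adjacency_other_part p (x x' : V p) (v : T) : tag v != p ->
  adjacency (backbone m Hb H) (Tagged V x) v =
  adjacency (backbone m Hb H) (Tagged V x') v.
Proof.
move=> vp; have ne y : Tagged V (y : V p) != v by apply: contraNneq vp => <-.
have pv y : tag (Tagged V (y : V p)) != tag v by rewrite eq_sym.
rewrite !backbone_adjacency // !lifted_adjacency0 //.
congr (_ + _); apply: eq_bigr => e _.
by rewrite (card_pair_crossings_move _ _ (u' := Tagged V x')) // eq_sym.
Qed.

End BackboneAdjacency.

(** The matrix E is extension by 0 of vectors on V_p, so the left-hand side consists
    of the rows of the backbone adjacency matrix indexed by V_p; up to the same error
    w in each, they are the rows of adj_mx (H p) - c extended by 0. *)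
Lemma embed_adj_mx (R : realType) (n : nat) (V : 'I_n -> finType) (m : nat)
    (Hb : hypergraph R 'I_n) (H : forall i, hypergraph R (V i)) (p : 'I_n) :
    (2 <= m)%N ->
  let c := \sum_(e in edges Hb | p \in e)
             weight Hb e * d_coef R (fun j => #|V j|) m e p in
  exists E w, row_free E /\
    E *m adj_mx (backbone m Hb H) =
    (adj_mx (H p) - c%:M) *m E + const_mx 1 *m (w : 'rV_#|{: {i : 'I_n & V i}}|).
Proof.
move=> m_ge2 c.
have /card_gt0P[x0 _] := vertex_gt0 (H p).
pose E : 'M[R]_(#|V p|, #|{: {i : 'I_n & V i}}|) :=
  \matrix_(a, b) (enum_val b == Tagged V (enum_val a))%:R.
(* In the columns of V_p, the row w supplies c also on the diagonal, where the
   adjacency is 0;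
   the term - c%:M compensates it. *)
pose w : 'rV[R]_#|{: {i : 'I_n & V i}}| := \row_b
  if tag (enum_val b) == p then c
  else adjacency (backbone m Hb H) (Tagged V x0) (enum_val b).
have rowE k (M : 'M[R]_(k, #|V p|)) a b :
    (M *m E) a b = \sum_x M a (enum_rank x) * (enum_val b == Tagged V x)%:R.
  rewrite mxE (reindex enum_rank) /=; last exact: onW_bij (enum_rank_bij _).
  by apply: eq_bigr => x _; rewrite mxE enum_rankK.
exists E, w; split.
  apply/row_freeP; exists E^T; apply/matrixP => a a'; rewrite mxE.
  rewrite (bigD1 (enum_rank (Tagged V (enum_val a)))) //= !mxE enum_rankK eqxx mul1r.
  rewrite eq_Tagged (inj_eq enum_val_inj) big1 ?addr0 // => b.
  rewrite -(inj_eq enum_val_inj) enum_rankK => /negPf nb.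
  by rewrite mxE nb mul0r.
apply/matrixP => a b; rewrite mxE.
rewrite (bigD1 (enum_rank (Tagged V (enum_val a)))) //= big1 => [|b']; last first.
  by rewrite -(inj_eq enum_val_inj) enum_rankK mxE => /negPf ->; rewrite mul0r.
rewrite addr0 [RHS]mxE rowE [X in _ + X]mxE big_ord1 !mxE enum_rankK eqxx !mul1r.
case: (enum_val b) => q v; rewrite -[existT _ _ _]/(Tagged V v).
have [qp|qp] /= := eqVneq q p; last first.
  rewrite big1 => [|x _].
    by rewrite add0r; apply: backbone_adjacency_other_part.
  have /negPf -> : Tagged V v != Tagged V x.
    by apply: contraNneq qp => /(congr1 tag) /= ->.
  by rewrite mulr0.
subst q; rewrite (bigD1 v) //= big1 => [|x xv]; last first.
  by rewrite eq_Tagged /= eq_sym (negPf xv) mulr0.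
rewrite eqxx mulr1 addr0 !mxE enum_rankK -(inj_eq enum_val_inj) enum_rankK.
have [<-|av] := eqVneq; last by rewrite backbone_adjacency_same_part // mulr0n subr0.
by rewrite /adjacency !eqxx mulr1n sub0r addNr.
Qed.

(** * The spectrum of the backbone construction *)

Theorem theorem3p1p1 (R : realType) (n : nat) (V : 'I_n -> finType) (m : nat)
    (Hb : hypergraph R 'I_n) (H : forall i : 'I_n, hypergraph R (V i))
    (m_ge2 : (2 <= m)%N)
    (m_ge_edges : forall e : {set 'I_n}, e \in edges Hb -> (#|e| <= m)%N)
    (H_uniform : forall i : 'I_n, uniform m (H i))
    (H_regular : forall i : 'I_n, regular (H i))
    (p : 'I_n) (r : R) (Hp_regular : regular_of r (H p))
    (lambda : R) (l : nat)
    (l_gt0 : (0 < l)%N)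
    (lambda_mult : nonperron_multiplicity (adj_mx (H p)) r lambda = l) :
  let mu := lambda - \sum_(e in edges Hb | p \in e)
                       weight Hb e * d_coef R (fun j => #|V j|) m e p in
  eigenvalue (adj_mx (backbone m Hb H)) mu /\
  (l <= multiplicity (adj_mx (backbone m Hb H)) mu)%N.
Proof.
move=> mu; have l_le : (l <= multiplicity (adj_mx (backbone m Hb H)) mu)%N.
  have [E [w [freeE EA]]] := embed_adj_mx Hb H p m_ge2.
  rewrite -lambda_mult.
  exact: mup_char_poly_embedding (vertex_gt0 (H p)) freeE (adj_mx_ones Hp_regular) EA.
split=> //; rewrite eigenvalue_root_char -dvdp_XsubCl XsubC_dvd ?char_poly_neq0 //.
exact: leq_trans l_gt0 l_le.
Qed.
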